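(* Let $\mathcal{A}$ be an associative conformal algebra, $M$ a conformal $\mathcal{A}$-bimodule, and $T:M\to\mathcal{A}$ a $\mathbb{C}[\partial]$-module homomorphism. Let $\hat T:\mathcal{A}\oplus M\to\mathcal{A}\oplus M$ be defined by $\hat T(a,m)=(T(m),0)$ for $a\in\mathcal{A}$, $m\in M$. Then $T$ is an $\mathcal{O}$-operator on $\mathcal{A}$ with respect to $M$ if and only if $\hat T$ is a Rota-Baxter operator (of weight $0$) on the semi-direct product associative conformal algebra $\mathcal{A}\oplus_0 M$.
   Context: All vector spaces are over $\mathbb{C}$. For $\mathbb{C}[\partial]$-modules $U,V,W$, a $\mathbb{C}$-bilinear map $U\times V\to W[\lambda]$, $(u,v)\mapsto u_\lambda v$, is conformal sesquilinear if $(\partial u)_\lambda v=-\lambda\, u_\lambda v$ and $u_\lambda(\partial v)=(\partial+\lambda)(u_\lambda v)$. Maps are extended coefficientwise to polynomials. An associative conformal algebra is a $\mathbb{C}[\partial]$-module $\mathcal{A}$ with a conformal sesquilinear map $(a,b)\mapsto a_\lambda b\in\mathcal{A}[\lambda]$ with $(a_\lambda b)_{\lambda+\mu}c=a_\lambda(b_\mu c)$. A conformal $\mathcal{A}$-bimodule is a $\mathbb{C}[\partial]$-module $M$ with conformal sesquilinear maps $(a,m)\mapsto a_\lambda m\in M[\lambda]$ and $(m,a)\mapsto m_\lambda a\in M[\lambda]$ such that $(a_\lambda b)_{\lambda+\mu}m=a_\lambda(b_\mu m)$, $(m_\lambda a)_{\lambda+\mu}b=m_\lambda(a_\mu b)$,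 $(a_\lambda m)_{\lambda+\mu}b=a_\lambda(m_\mu b)$. An $\mathcal{O}$-operator on $\mathcal{A}$ with respect to $M$ is a $\mathbb{C}[\partial]$-module homomorphism $T:M\to\mathcal{A}$ with $T(m)_\lambda T(n)=T(T(m)_\lambda n+m_\lambda T(n))$ for all $m,n\in M$. A Rota-Baxter operator (of weight $0$) on an associative conformal algebra $\mathcal{B}$ is a $\mathbb{C}[\partial]$-module homomorphism $R:\mathcal{B}\to\mathcal{B}$ with $R(x)_\lambda R(y)=R(R(x)_\lambda y+x_\lambda R(y))$ for all $x,y\in\mathcal{B}$. $\mathcal{A}\oplus_0 M$ is the $\mathbb{C}[\partial]$-module $\mathcal{A}\oplus M$ with the associative $\lambda$-multiplication $(a,m)_\lambda(b,n)=(a_\lambda b,\;a_\lambda n+m_\lambda b)$. *)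

(* Defs.v *)
From HB Require Import structures.
From mathcomp Require Import all_boot all_order all_algebra.
From mathcomp Require Import reals complex finmap monalg.

Set Implicit Arguments.
Unset Strict Implicit.
Unset Printing Implicit Defensive.

Import GRing.Theory.
Local Open Scope ring_scope.

(* C[d] is {poly K} with d := 'X, so a C[d]-module is an lmodType {poly K}
   (K is the complex field in the theorem), its elements d u and c u being
   'X *: u and c%:P *: u.  *)

(* W[lambda]: the coefficient of lambda^n in p is p@_n.  W[x][y] is
   {lpoly {lpoly W}}, where p@_i@_j is the coefficient of x^j y^i.  *)
Notation "{ 'lpoly' W }" := {malg W[nat]}
  (at level 0, W at level 2, format "{ 'lpoly'  W }") : type_scope.

Section LambdaPolynomials.
Variables U W : zmodType.

(* Coefficientwise extension U[lambda] -> W[lambda] of a map f with f 0 = 0. *)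
Definition mapc (f : U -> W) (p : {lpoly U}) : {lpoly W} :=
  [malg n in msupp p => f p@_n].

(* Multiplication by lambda. *)
Definition mullam (p : {lpoly W}) : {lpoly W} :=
  \sum_(n <- msupp p) << p@_n *g n.+1 >>.

(* The substitution nu := lambda + mu, from W[nu][lambda] to W[lambda][mu]:
   w nu^j lambda^i |-> \sum_(k <= j) 'C(j, k) w lambda^(i + j - k) mu^k.  *)
Definition subst_add (p : {lpoly {lpoly W}}) : {lpoly {lpoly W}} :=
  \sum_(i <- msupp p) \sum_(j <- msupp p@_i) \sum_(k < j.+1)
     << << p@_i@_j *+ 'C(j, k) *g (i + (j - k))%N >> *g (k : nat) >>.

End LambdaPolynomials.

(* Coefficientwise action of C[d] on W[lambda]. *)
Definition lscale (K : fieldType) (W : lmodType {poly K}) (q : {poly K})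
  (p : {lpoly W}) : {lpoly W} := mapc (fun w => q *: w) p.

Definition conformal_sesquilinear (K : fieldType) (U V W : lmodType {poly K})
    (f : U -> V -> {lpoly W}) : Prop :=
  [/\ forall (c : K) u u' v,
        f (c%:P *: u + u') v = lscale c%:P (f u v) + f u' v,
      forall (c : K) u v v',
        f u (c%:P *: v + v') = lscale c%:P (f u v) + f u v',
      forall u v, f ('X *: u) v = - mullam (f u v) &
      forall u v, f u ('X *: v) = lscale 'X (f u v) + mullam (f u v)].

(* (x_lambda y)_{lambda+mu} z = x_lambda (y_mu z), in W[lambda][mu]. *)
Definition conformal_assoc (X Y Z XY YZ W : zmodType)
    (fXY : X -> Y -> {lpoly XY}) (fXY_Z : XY -> Z -> {lpoly W})
    (fYZ : Y -> Z -> {lpoly YZ}) (fX_YZ : X -> YZ -> {lpoly W}) : Prop :=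
  forall x y z,
    subst_add (mapc (fun t => fXY_Z t z) (fXY x y)) = mapc (fX_YZ x) (fYZ y z).

HB.mixin Record isAssocConformal (K : fieldType) A
    of GRing.Lmodule {poly K} A := {
  lmul : A -> A -> {lpoly A};
  lmul_sesqui : conformal_sesquilinear lmul;
  lmulA : conformal_assoc lmul lmul lmul lmul
}.

#[short(type="assocConformalType")]
HB.structure Definition AssocConformal (K : fieldType) :=
  { A of GRing.Lmodule {poly K} A & isAssocConformal K A }.

HB.mixin Record isConformalBimodule (K : fieldType) (A : assocConformalType K) M
    of GRing.Lmodule {poly K} M := {
  lact : A -> M -> {lpoly M};
  ract : M -> A -> {lpoly M};
  lact_sesqui : conformal_sesquilinear lact;
  ract_sesqui : conformal_sesquilinear ract;
  lact_lmul : conformal_assoc lmul lact lact lact;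
  ract_lmul : conformal_assoc ract ract lmul ract;
  lact_ract : conformal_assoc lact ract ract lact
}.

#[short(type="conformalBimodType")]
HB.structure Definition ConformalBimodule (K : fieldType)
    (A : assocConformalType K) :=
  { M of GRing.Lmodule {poly K} M & isConformalBimodule K A M }.

Section Coefficients.

Lemma mapcE (U W : zmodType) (f : U -> W) p n :
  f 0 = 0 -> (mapc f p)@_n = f p@_n.
Proof. by move=> f0; rewrite mcoeffE; case: msuppP => // _; rewrite f0. Qed.

Lemma mullamE (W : zmodType) (p : {lpoly W}) n :
  (mullam p)@_n = if n is m.+1 then p@_m else 0.
Proof.
rewrite raddf_sum /=; case: n => [|m].
  by rewrite big1 // => i _; rewrite mcoeffU.
rewrite [in RHS](monalgE p) raddf_sum /=.
by apply: eq_bigr => i _; rewrite !mcoeffU eqSS.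
Qed.

Lemma lscaleE (K : fieldType) (W : lmodType {poly K}) q (p : {lpoly W}) n :
  (lscale q p)@_n = q *: p@_n.
Proof. by rewrite mapcE ?scaler0. Qed.

Lemma subst_addE (W : zmodType) (p : {lpoly {lpoly W}}) k l :
  (subst_add p)@_k@_l =
    \sum_(i < l.+1) p@_(i : nat)@_(k + l - i)%N *+ 'C(k + l - i, k).
Proof.
pose F i := if (i <= l)%N then p@_i@_(k + l - i)%N *+ 'C(k + l - i, k) else 0.
have -> : (subst_add p)@_k@_l = \sum_(i <- msupp p) F i.
  rewrite raddf_sum raddf_sum /=; apply: eq_bigr => i _.
  pose G j := if (k <= j)%N && (i + (j - k) == l)%N
              then p@_i@_j *+ 'C(j, k) else 0.
  have -> : ((\sum_(j <- msupp p@_i) \sum_(k0 < j.+1)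
     << << p@_i@_j *+ 'C(j, k0) *g (i + (j - k0))%N >> *g (k0 : nat) >>)@_k)@_l
     = \sum_(j <- msupp p@_i) G j.
    rewrite raddf_sum raddf_sum /=; apply: eq_bigr => j _.
    rewrite raddf_sum raddf_sum /= /G.
    have [lekj|ltjk] /= := leqP k j.
      have ltk : (k < j.+1)%N by [].
      rewrite (bigD1 (Ordinal ltk)) //= big1 ?addr0 => [|k' nk].
        by rewrite mcoeffUU mcoeffU; case: eqP.
      rewrite mcoeffU; case: eqP => [e|_]; last by rewrite mcoeff0.
      by case/eqP: nk; apply: val_inj.
    rewrite big1 // => k' _; rewrite mcoeffU.
    case: eqP => [e|_]; last by rewrite mcoeff0.
    by have := ltn_ord k'; rewrite e ltnS leqNgt ltjk.
  have GE j : (j != k + l - i)%N || (l < i)%N -> G j = 0.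
    rewrite /G => H; case: ifP => // /andP[lekj /eqP el]; move: H.
    rewrite -el [(_ < i)%N]ltnNge leq_addr orbF => /eqP []. 
    by rewrite addnCA (subnKC lekj) addKn.
  rewrite /F; have [leil|ltli] := leqP i l; last first.
    by rewrite big1 // => j _; apply: GE; rewrite ltli orbT.
  have Gv : G (k + l - i)%N = p@_(i : nat)@_(k + l - i)%N *+ 'C(k + l - i, k).
    rewrite /G; have -> : (k <= k + l - i)%N by rewrite -addnBA // leq_addr.
    by rewrite -addnBA // addKn subnKC // eqxx.
  rewrite -Gv; case: (msuppP p@_i (k + l - i)%N) => [inS|notin] //.
    by rewrite (big_fsetD1 _ inS) /= big1_fset ?addr0 // => j;
       rewrite !inE => /andP[nj _] _; apply: GE; rewrite nj.
  rewrite {2}/G (mcoeff_outdom notin) mul0rn if_same.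
  rewrite big1_fset // => j jS _; apply: GE.
  by case: eqP => // ej; rewrite -ej jS in notin.
have F0 i : p@_i = 0 -> F i = 0.
  by move=> pi0; rewrite /F pi0 mcoeff0 mul0rn if_same.
have -> : \sum_(i < l.+1) p@_(i : nat)@_(k + l - i)%N *+ 'C(k + l - i, k)
          = \sum_(i < l.+1) F i.
  by apply: eq_bigr => i _; rewrite /F -ltnS ltn_ord.
rewrite -(big_mkord xpredT F) [RHS](bigID (mem (msupp p))) /=.
rewrite [X in _ = _ + X]big1 ?addr0; last first.
  by move=> i /mcoeff_outdom /F0.
rewrite [LHS](bigID (fun i => i <= l)%N) /= [X in _ + X = _]big1 ?addr0;
  last by move=> i /negbTE; rewrite /F => ->.
rewrite -big_filter -[RHS]big_filter; apply: perm_big; apply: uniq_perm.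
- by rewrite filter_uniq ?fset_uniq.
- by rewrite filter_uniq ?iota_uniq.
by move=> i; rewrite !mem_filter mem_index_iota andbC /= ltnS.
Qed.

End Coefficients.

Section Sesquilinear.
Variables (K : fieldType) (U V W : lmodType {poly K}).
Variable f : U -> V -> {lpoly W}.
Hypothesis fS : conformal_sesquilinear f.

Lemma sesquiDl u u' v : f (u + u') v = f u v + f u' v.
Proof.
case: fS => /(_ 1 u u' v) + _ _ _; rewrite polyC1 scale1r => ->.
by congr (_ + _); apply/malgP => n; rewrite lscaleE scale1r.
Qed.

Lemma sesquiDr u v v' : f u (v + v') = f u v + f u v'.
Proof.
case: fS => _ /(_ 1 u v v') + _ _; rewrite polyC1 scale1r => ->.
by congr (_ + _); apply/malgP => n; rewrite lscaleE scale1r.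
Qed.

Lemma sesqui0l v : f 0 v = 0.
Proof. by apply: (@addrI _ (f 0 v)); rewrite -sesquiDl !addr0. Qed.

Lemma sesqui0r u : f u 0 = 0.
Proof. by apply: (@addrI _ (f u 0)); rewrite -sesquiDr !addr0. Qed.

End Sesquilinear.

Lemma conformal_assocE (X Y Z XY YZ W : zmodType)
    (fXY : X -> Y -> {lpoly XY}) (fXY_Z : XY -> Z -> {lpoly W})
    (fYZ : Y -> Z -> {lpoly YZ}) (fX_YZ : X -> YZ -> {lpoly W}) :
  (forall z, fXY_Z 0 z = 0) -> (forall x, fX_YZ x 0 = 0) ->
  conformal_assoc fXY fXY_Z fYZ fX_YZ <->
  forall x y z k l,
    \sum_(i < l.+1) (fXY_Z (fXY x y)@_(i : nat) z)@_(k + l - i)%N *+ 'C(k + l - i, k)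
    = (fX_YZ x (fYZ y z)@_k)@_l.
Proof.
move=> f0 g0; split=> [H x y z k l | H x y z].
  rewrite -[in RHS](mapcE (f := fX_YZ x)) // -H subst_addE.
  by apply: eq_bigr => i _; rewrite mapcE.
apply/malgP => k; apply/malgP => l; rewrite subst_addE mapcE // -H.
by apply: eq_bigr => i _; rewrite mapcE.
Qed.

(* A (+)_0 M, as an alias of A * M, which itself gets no lambda-product. *)
Definition semidirect (K : fieldType) (A : assocConformalType K)
  (M : conformalBimodType A) : Type := (A * M)%type.

HB.instance Definition _ (K : fieldType) (A : assocConformalType K)
    (M : conformalBimodType A) :=
  GRing.Lmodule.copy (semidirect M) (A * M)%type.

Section SemiDirect.
Variables (K : fieldType) (A : assocConformalType K) (M : conformalBimodType A).
Implicit Types x y z : semidirect M.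

Definition sd_mul x y : {lpoly semidirect M} :=
  mapc (fun a : A => (a, 0) : semidirect M) (lmul x.1 y.1)
  + mapc (fun m : M => (0, m) : semidirect M) (lact x.1 y.2 + ract x.2 y.1).

Lemma sd_mulE x y n : (sd_mul x y)@_n =
  ((lmul x.1 y.1)@_n, (lact x.1 y.2)@_n + (ract x.2 y.1)@_n).
Proof. by rewrite mcoeffD !mapcE // mcoeffD; congr pair; rewrite /= ?addr0 ?add0r. Qed.

Lemma sd_mul_sesqui : conformal_sesquilinear sd_mul.
Proof.
have [a1 a2 a3 a4] := @lmul_sesqui K A.
have [l1 l2 l3 l4] := @lact_sesqui K A M.
have [r1 r2 r3 r4] := @ract_sesqui K A M.
split=> [c u u' v|c u v v'|u v|u v]; apply/malgP=> n; rewrite sd_mulE.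
- rewrite [RHS]mcoeffD lscaleE !sd_mulE /= a1 l1 r1 !mcoeffD !lscaleE.
  by congr pair; rewrite /= scalerDr addrACA.
- rewrite [RHS]mcoeffD lscaleE !sd_mulE /= a2 l2 r2 !mcoeffD !lscaleE.
  by congr pair; rewrite /= scalerDr addrACA.
- rewrite [RHS]mcoeffN mullamE /= a3 l3 r3 !mcoeffN !mullamE.
  case: n => [|n]; rewrite ?sd_mulE.
    by congr pair; rewrite /= oppr0 addr0.
  by congr pair; rewrite /= opprD.
rewrite [RHS]mcoeffD lscaleE mullamE !sd_mulE /= a4 l4 r4 !mcoeffD !lscaleE.
rewrite !mullamE; case: n => [|n]; rewrite ?sd_mulE.
  by congr pair; rewrite /= !addr0 scalerDr.
by congr pair; rewrite /= scalerDr addrACA.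
Qed.

Lemma sd_mulA : conformal_assoc sd_mul sd_mul sd_mul sd_mul.
Proof.
have aS := @lmul_sesqui K A.
have lS := @lact_sesqui K A M.
have rS := @ract_sesqui K A M.
have aaE := (conformal_assocE _ _ (sesqui0l aS) (sesqui0r aS)).1 (@lmulA K A).
have alE :=
  (conformal_assocE _ _ (sesqui0l lS) (sesqui0r lS)).1 (@lact_lmul K A M).
have raE :=
  (conformal_assocE _ _ (sesqui0l rS) (sesqui0r rS)).1 (@ract_lmul K A M).
have lrE :=
  (conformal_assocE _ _ (sesqui0l rS) (sesqui0r lS)).1 (@lact_ract K A M).
have dS := sd_mul_sesqui.
apply/(conformal_assocE _ _ (sesqui0l dS) (sesqui0r dS)) => x y z k l.
rewrite [RHS]sd_mulE sd_mulE /= (sesquiDr lS) mcoeffD -aaE -alE -raE -lrE.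
rewrite -addrA -!big_split /=.
set s := LHS; have -> : s = (s.1, s.2) by case: s.
congr pair; rewrite {}/s raddf_sum /=; apply: eq_bigr => i _;
  rewrite raddfMn /= !sd_mulE /= //.
by rewrite (sesquiDl rS) mcoeffD !mulrnDl.
Qed.

HB.instance Definition _ :=
  isAssocConformal.Build K (semidirect M) sd_mul_sesqui sd_mulA.

End SemiDirect.

(* "linear T" is over {poly K}: T is a C[d]-module homomorphism. *)
Definition O_operator (K : fieldType) (A : assocConformalType K)
    (M : conformalBimodType A) (T : M -> A) : Prop :=
  linear T /\
  forall m n : M,
    lmul (T m) (T n) = mapc T (lact (T m) n + ract m (T n)).

Definition Rota_Baxter (K : fieldType) (B : assocConformalType K)
    (P : B -> B) : Prop :=
  linear P /\
  forall x y : B,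
    lmul (P x) (P y) = mapc P (lmul (P x) y + lmul x (P y)).

Definition hat (K : fieldType) (A : assocConformalType K)
    (M : conformalBimodType A) (T : M -> A) : semidirect M -> semidirect M :=
  fun x => (T x.2, 0).

(* Main.v *)
Require Import Defs.
From mathcomp Require Import all_boot all_order all_algebra.
From mathcomp Require Import reals complex.
From mathcomp Require Import monalg.

Import GRing.Theory.

(** [hat T] reads only the M-component and lands in $\mathcal{A}\oplus 0$. Hence, at $(a,m)$,
    $(b,n)$, both sides of the Rota-Baxter identity have M-component 0, and their A-components are
    the two sides of the O-operator identity at $m,n$, whatever $a$ and $b$ are. [lmul_hatE] and
    [mapc_hatE] show this coefficient by coefficient. *)

Section HatOperator.
Local Open Scope ring_scope.
Variables (K : fieldType) (A : assocConformalType K) (M : conformalBimodType A).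
Variable T : {linear M -> A}.
Implicit Types x y : semidirect M.

Lemma hat_linear : linear (hat T : semidirect M -> semidirect M).
Proof.
move=> c x y; rewrite /hat /= linearP.
by congr pair; rewrite /= scaler0 addr0.
Qed.

Lemma lmul_semidirectE x y n : (lmul x y)@_n =
  ((lmul x.1 y.1)@_n, (lact x.1 y.2)@_n + (ract x.2 y.1)@_n).
Proof. exact: sd_mulE. Qed.

Lemma lmul_hatE x y n :
  (lmul (hat T x) (hat T y))@_n = ((lmul (T x.2) (T y.2))@_n, 0).
Proof.
rewrite lmul_semidirectE /= (sesqui0r (@lact_sesqui K A M)).
by rewrite (sesqui0l (@ract_sesqui K A M)) !mcoeff0 addr0.
Qed.

(** [x.1] and [y.1] reach the M-component only through products with the zero M-component of a value
    of [hat T], and the outer [hat T] discards the A-component. *)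
Lemma mapc_hatE x y n :
  (mapc (hat T) (lmul (hat T x) y + lmul x (hat T y)))@_n =
  ((mapc T (lact (T x.2) y.2 + ract x.2 (T y.2)))@_n, 0).
Proof.
rewrite [LHS]mapcE; last by rewrite /hat linear0.
rewrite [in RHS]mapcE ?linear0 // [in LHS]mcoeffD !lmul_semidirectE mcoeffD /=.
rewrite (sesqui0l (@ract_sesqui K A M)) (sesqui0r (@lact_sesqui K A M)).
by rewrite !mcoeff0 /hat /= addr0 add0r.
Qed.

End HatOperator.

Theorem proposition3p3 (R : realType) (A : assocConformalType R[i])
    (M : conformalBimodType A) (T : {linear M -> A}) :
  O_operator T <-> Rota_Baxter (hat T).
Proof.
split=> [[_ TO] | [_ RB]]; split.
- exact: hat_linear.
- by move=> x y; apply/malgP => n; rewrite lmul_hatE mapc_hatE TO.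
- exact: linearP.
move=> u v; apply/malgP => n.
(* Any A-components would do, since they drop out; 0 is chosen. *)
have := congr1 (fun p => mcoeff n p) (RB (0%R, u) (0%R, v)).
by rewrite lmul_hatE mapc_hatE => -[].
Qed.
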